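(* Let $\mathscr{F}\subseteq\mathscr{P}(\omega)$ be an $\omega$-closed family with $\varnothing\in\mathscr{F}$, and suppose that $\boldsymbol{B}_{\mathbb{Z}}^{\mathscr{F}}$ is a $0$-bisimple semigroup. Then exactly one of the following conditions holds: (1) the semigroup $\boldsymbol{B}_{\mathbb{Z}}^{\mathscr{F}}$ is isomorphic to the semigroup of $\omega\times\omega$-matrix units $\boldsymbol{\mathcal{B}}_\omega$; (2) the semigroup $\boldsymbol{B}_{\mathbb{Z}}^{\mathscr{F}}$ is isomorphic to the semigroup $\boldsymbol{B}_{\mathbb{Z}}^{(0,j_0)}$ for some positive integer $j_0$.
   Context: $\omega$ is the set of non-negative integers and $\mathscr{P}(\omega)$ is the family of all its subsets. For $n\in\mathbb{Z}$ and $A\subseteq\mathbb{Z}$ put $n+A=\{n+a: a\in A\}$ (so $n+\varnothing=\varnothing$). A family $\mathscr{F}\subseteq\mathscr{P}(\omega)$ is $\omega$-closed if $F_1\cap(-n+F_2)\in\mathscr{F}$ for all $n\in\omega$ and $F_1,F_2\in\mathscr{F}$. For an $\omega$-closed family $\mathscr{F}$, the set $\mathbb{Z}\times\mathbb{Z}\times\mathscr{F}$ carries the associative operation $$(i_1,j_1,F_1)\cdot(i_2,j_2,F_2)=\begin{cases}(i_1-j_1+i_2,\;j_2,\;(j_1-i_2+F_1)\cap F_2), & j_1<i_2;\\ (i_1,\;j_2,\;F_1\cap F_2), & j_1=i_2;\\ (i_1,\;j_1-i_2+j_2,\;F_1\cap(i_2-j_1+F_2)), & j_1>i_2.\end{cases}$$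 When $\varnothing\in\mathscr{F}$, $\boldsymbol{I}=\{(i,j,\varnothing): i,j\in\mathbb{Z}\}$ is an ideal and $\boldsymbol{B}_{\mathbb{Z}}^{\mathscr{F}}$ is defined as the Rees quotient $(\mathbb{Z}\times\mathbb{Z}\times\mathscr{F},\cdot)/\boldsymbol{I}$ ($\boldsymbol{I}$ is collapsed to one element, the zero). For $i_0\in\omega$ and a positive integer $j_0$, put $j_0\omega=\{j_0\cdot i: i\in\omega\}$ and $\boldsymbol{B}_{\mathbb{Z}}^{(i_0,j_0)}=\boldsymbol{B}_{\mathbb{Z}}^{\mathscr{F}}$ for the ($\omega$-closed) family $\mathscr{F}=\{\varnothing,\,i_0+j_0\omega\}$. The semigroup of $\omega\times\omega$-matrix units is $\boldsymbol{\mathcal{B}}_\omega=(\omega\times\omega)\sqcup\{0\}$ with $(a,b)\cdot(c,d)=(a,d)$ if $b=c$, $(a,b)\cdot(c,d)=0$ if $b\neq c$, and $(a,b)\cdot0=0\cdot(a,b)=0\cdot0=0$. An inverse semigroup $S$ with zero $0$ is $0$-bisimple if it has exactly two $\mathscr{D}$-classes: $S\setminus\{0\}$ and $\{0\}$. *)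

(* Defs.v *)
From HB Require Import structures.
From mathcomp Require Import all_boot all_order all_algebra.
From mathcomp Require Import boolp classical_sets.
From mathcomp Require Import zify ring.

Set Implicit Arguments.
Unset Strict Implicit.
Unset Printing Implicit Defensive.

Import Order.TTheory GRing.Theory Num.Theory.

Local Open Scope classical_set_scope.
Local Open Scope ring_scope.
Local Open Scope quotient_scope.

Section Semigroups.
Variable S : semigroupType.
Local Open Scope group_scope.

Definition inverse_semigroup : Prop :=
  forall x : S, exists! y : S, x * y * x = x /\ y * x * y = y.

Definition is_zero (z : S) : Prop := forall x : S, z * x = z /\ x * z = z.

(* [S^1 x] and [x S^1], without adjoining a unit to [S]. *)
Definition left_ideal1 (x : S) : set S := x |` [set s * x | s in setT].
Definition right_ideal1 (x : S) : set S := x |` [set x * s | s in setT].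

Definition greenL (x y : S) : Prop := left_ideal1 x = left_ideal1 y.
Definition greenR (x y : S) : Prop := right_ideal1 x = right_ideal1 y.
(* [D] is the composition of [L] and [R], which commute. *)
Definition greenD (x y : S) : Prop := exists z : S, greenL x z /\ greenR z y.

Definition Dclass (x : S) : set S := [set y | greenD x y].

(* A D-class is nonempty, so the equality of sets of classes below also forces
   [S] to have a nonzero element. *)
Definition zero_bisimple : Prop :=
  inverse_semigroup /\
  exists2 z : S, is_zero z & range Dclass = [set ~` [set z]; [set z]].

Record ideal := Ideal {
  ideal_set : set S;
  ideal_nonempty : ideal_set !=set0;
  ideal_mull : forall s x, ideal_set x -> ideal_set (s * x);
  ideal_mulr : forall s x, ideal_set x -> ideal_set (x * s) }.

End Semigroups.

Definition isomorphic (S T : semigroupType) : Prop :=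
  exists f : {multiplicative S -> T}, bijective f.

Section ReesQuotient.
Variables (S : semigroupType) (I : ideal S).
Local Open Scope group_scope.

Definition rees_rel (x y : S) : bool := `[< x = y \/ ideal_set I x /\ ideal_set I y >].

Lemma rees_rel_refl : reflexive rees_rel.
Proof. by move=> x; apply/asboolP; left. Qed.

Lemma rees_rel_sym : symmetric rees_rel.
Proof.
by move=> x y; apply/asboolP/asboolP => -[->|[? ?]]; [left|right|left|right].
Qed.

Lemma rees_rel_trans : transitive rees_rel.
Proof.
move=> y x z /asboolP xy /asboolP yz; apply/asboolP.
case: xy yz => [->//|[Ix Iy]] [<-|[_ Iz]]; by right.
Qed.

Canonical rees_equiv := EquivRel rees_rel rees_rel_refl rees_rel_sym rees_rel_trans.

Definition rees : Type := {eq_quot rees_equiv}.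
HB.instance Definition _ := Choice.on rees.
HB.instance Definition _ := EqQuotient.on rees.

Definition rees_mul (x y : rees) : rees := \pi_rees (repr x * repr y).

Lemma rees_piP (x y : S) :
  reflect (x = y \/ ideal_set I x /\ ideal_set I y) (\pi_rees x == \pi_rees y).
Proof. by rewrite eqmodE; apply: asboolP. Qed.

Lemma pi_rees_mul (x y : S) :
  rees_mul (\pi_rees x) (\pi_rees y) = \pi_rees (x * y).
Proof.
apply/eqP/rees_piP.
have /rees_piP : \pi_rees (repr (\pi_rees x)) == \pi_rees x by rewrite reprK.
have /rees_piP : \pi_rees (repr (\pi_rees y)) == \pi_rees y by rewrite reprK.
move=> [->|[Iy Iy']] [->|[Ix Ix']]; first by left.
- by right; split; apply: ideal_mulr.
- by right; split; apply: ideal_mull.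
- by right; split; apply: ideal_mull.
Qed.

Lemma rees_mulA : associative rees_mul.
Proof.
elim/quotW=> x; elim/quotW=> y; elim/quotW=> z.
by rewrite (pi_rees_mul y) (pi_rees_mul x) (pi_rees_mul x) (pi_rees_mul (x * y)) mulgA.
Qed.

HB.instance Definition _ := isSemigroup.Build rees rees_mulA.

End ReesQuotient.

Definition omega : set int := range Posz.

Definition shift (n : int) (A : set int) : set int := [set n + a | a in A].

Lemma shiftE n A : shift n A = [set k | A (k - n)].
Proof.
apply/seteqP; split=> [k [a Aa <-]|k Akn] /=; first by rewrite addrC addKr.
by exists (k - n) => //; rewrite addrC subrK.
Qed.

Lemma shift0 A : shift 0 A = A.
Proof. by rewrite shiftE; apply/funext=> k /=; rewrite subr0. Qed.

Lemma shiftD m n A : shift m (shift n A) = shift (m + n) A.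
Proof. by rewrite !shiftE; apply/funext=> k /=; rewrite opprD addrA. Qed.

Lemma shiftI n A B : shift n (A `&` B) = shift n A `&` shift n B.
Proof. by rewrite !shiftE. Qed.

Record omegaFamily := OmegaFamily {
  omega_fam : set (set int);
  omega_fam_sub : forall A, omega_fam A -> A `<=` omega;
  omega_fam_closed : forall (n : nat) F1 F2,
    omega_fam F1 -> omega_fam F2 -> omega_fam (F1 `&` shift (- n%:Z) F2) }.

Definition bz_rawmul (x y : int * int * set int) : int * int * set int :=
  let: (i1, j1, F1) := x in
  let: (i2, j2, F2) := y in
  if j1 < i2 then (i1 - j1 + i2, j2, shift (j1 - i2) F1 `&` F2)
  else if j1 == i2 then (i1, j2, F1 `&` F2)
  else (i1, j1 - i2 + j2, F1 `&` shift (i2 - j1) F2).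

Lemma bz_rawmulE i1 j1 F1 i2 j2 F2 :
  bz_rawmul (i1, j1, F1) (i2, j2, F2) =
  (i1 + Num.max 0 (i2 - j1), j2 + Num.max 0 (j1 - i2),
   shift (Num.min 0 (j1 - i2)) F1 `&` shift (Num.min 0 (i2 - j1)) F2).
Proof.
rewrite /bz_rawmul; case: ltgtP => h.
- have -> : Num.max 0 (i2 - j1) = i2 - j1 by lia.
  have -> : Num.max 0 (j1 - i2) = 0 by lia.
  have -> : Num.min 0 (i2 - j1) = 0 by lia.
  have -> : Num.min 0 (j1 - i2) = j1 - i2 by lia.
  by rewrite shift0; congr (_, _, _); lia.
- have -> : Num.max 0 (i2 - j1) = 0 by lia.
  have -> : Num.max 0 (j1 - i2) = j1 - i2 by lia.
  have -> : Num.min 0 (j1 - i2) = 0 by lia.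
  have -> : Num.min 0 (i2 - j1) = i2 - j1 by lia.
  by rewrite shift0; congr (_, _, _); lia.
- by rewrite h subrr maxxx minxx !shift0 !addr0.
Qed.

Lemma bz_rawmulA : associative bz_rawmul.
Proof.
move=> [[i1 j1] F1] [[i2 j2] F2] [[i3 j3] F3].
rewrite !bz_rawmulE !shiftI !shiftD setIA.
congr (_, _, _ `&` _ `&` _); rewrite ?shiftD; try lia;
by congr shift; lia.
Qed.

Section BZ.
Variable F : omegaFamily.

Definition bz_ext : Type := int * int * set_type (omega_fam F).
HB.instance Definition _ := Choice.on bz_ext.

Definition bz_raw (x : bz_ext) : int * int * set int := (x.1, val x.2).

Lemma bz_raw_inj : injective bz_raw.
Proof. by move=> [x A] [y B] [-> /val_inj ->]. Qed.

Lemma bz_mul_subproof (x y : bz_ext) :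
  (bz_rawmul (bz_raw x) (bz_raw y)).2 \in omega_fam F.
Proof.
case: x y => [[i1 j1] [F1 F1P]] [[i2 j2] [F2 F2P]]; rewrite /bz_raw /=.
move: F1P F2P => /set_mem F1P /set_mem F2P; apply/mem_set.
have subE (a b : int) : a < b -> a - b = - (`|b - a|%N)%:Z by lia.
case: ltgtP => [h|h|_] /=.
- by rewrite setIC subE//; apply: omega_fam_closed.
- by rewrite subE//; apply: omega_fam_closed.
- by have := omega_fam_closed 0 F1P F2P; rewrite oppr0 shift0.
Qed.

Definition bz_mul (x y : bz_ext) : bz_ext :=
  ((bz_rawmul (bz_raw x) (bz_raw y)).1,
   exist _ (bz_rawmul (bz_raw x) (bz_raw y)).2 (bz_mul_subproof x y)).

Lemma bz_raw_mul x y : bz_raw (bz_mul x y) = bz_rawmul (bz_raw x) (bz_raw y).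
Proof. by rewrite [RHS]surjective_pairing. Qed.

Lemma bz_mulA : associative bz_mul.
Proof.
by move=> x y z; apply: bz_raw_inj; rewrite !bz_raw_mul bz_rawmulA.
Qed.

HB.instance Definition _ := isSemigroup.Build bz_ext bz_mulA.

Definition bz_null : set bz_ext := [set x | val x.2 = set0].

Hypothesis F0 : omega_fam F set0.

Lemma bz_null_nonempty : bz_null !=set0.
Proof. by exists (0, 0, exist _ set0 (mem_set F0)). Qed.

Lemma bz_null_mull (s x : bz_ext) : bz_null x -> bz_null (s * x)%g.
Proof.
case: s x => [[i1 j1] [F1 F1P]] [[i2 j2] [F2 F2P]]; rewrite /bz_null /= => ->.
by rewrite /shift; case: ltgtP => _ /=; rewrite ?image_set0 setI0.
Qed.

Lemma bz_null_mulr (s x : bz_ext) : bz_null x -> bz_null (x * s)%g.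
Proof.
case: s x => [[i1 j1] [F1 F1P]] [[i2 j2] [F2 F2P]]; rewrite /bz_null /= => ->.
by rewrite /shift; case: ltgtP => _ /=; rewrite ?image_set0 set0I.
Qed.

Definition bz_ideal : ideal bz_ext :=
  Ideal bz_null_nonempty bz_null_mull bz_null_mulr.

Definition BZ : semigroupType := rees bz_ideal.

End BZ.

Section Progression.
Variables i0 j0 : nat.

Definition progression : set int := shift i0%:Z [set j0%:Z * i | i in omega].

Definition prog_set : set (set int) := [set set0; progression].

Lemma prog_set_sub A : prog_set A -> A `<=` omega.
Proof.
case=> -> // k [_ [_ [i _ <-] <-] <-].
by exists (i0 + j0 * i)%N => //; rewrite PoszD PoszM.
Qed.

Lemma prog_set_closed (n : nat) F1 F2 :
  prog_set F1 -> prog_set F2 -> prog_set (F1 `&` shift (- n%:Z) F2).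
Proof.
case=> ->; first by left; rewrite set0I.
case=> ->; first by left; rewrite /shift image_set0 setI0.
have [/dvdnP[q ->]|ndvd] := boolP (j0 %| n)%N; [right|left].
  apply: setIidl => _ [_ [_ [i _ <-] <-] <-]; rewrite shiftE /=.
  exists (j0%:Z * (i + q)%N%:Z); last by rewrite !PoszD PoszM; ring.
  by exists (i + q)%N%:Z => //; exists (i + q)%N.
apply/seteqP; split=> // k [[_ [_ [a _ <-] <-] <-]]; rewrite shiftE /=.
move=> [_ [_ [b _ <-] <-] eq]; move: ndvd; apply/negP/negPn.
have e : (j0 * b = n + j0 * a)%N by nia.
by rewrite -(@dvdn_addl (j0 * a)%N) ?dvdn_mulr// -e dvdn_mulr.
Qed.

Definition prog_family : omegaFamily :=
  OmegaFamily prog_set_sub prog_set_closed.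

Lemma prog_family0 : omega_fam prog_family set0.
Proof. by left. Qed.

(* The family is omega-closed also for [j0 = 0], where the progression is the
   singleton of [i0]; positivity of [j0] is left to the statements. *)
Definition BZprog : semigroupType := BZ prog_family0.

End Progression.

Definition matrix_units : Type := option (nat * nat).
HB.instance Definition _ := Choice.on matrix_units.

Definition matrix_units_mul (x y : matrix_units) : matrix_units :=
  match x, y with
  | Some (a, b), Some (c, d) => if b == c then Some (a, d) else None
  | _, _ => None
  end.

Lemma matrix_units_mulA : associative matrix_units_mul.
Proof.
case=> [[a b]|] [[c d]|] [[e f]|] //=; last by case: (b == c).
by case: (eqVneq d e) => [->|/negPf de]; case: (eqVneq b c) => [_|_] //=;
  rewrite ?eqxx ?de.
Qed.

HB.instance Definition _ := isSemigroup.Build matrix_units matrix_units_mulA.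

(* Main.v *)
(** Green's relations in the Rees quotient preserve the third coordinate of a
    nonzero element, so 0-bisimplicity forces the family to be [{set0, A}] with
    [A] nonempty. Closedness then says that [A] contains each of its translates
    by [n >= 0] that it meets, so [A] is a singleton or an arithmetic
    progression. In the first case the semigroup consists of matrix units over
    [int]; in the second, translating [A] to start at [0] is an isomorphism since
    the product only sees relative shifts. *)

Require Import Defs.
From mathcomp Require Import all_boot all_order all_algebra.
From mathcomp Require Import boolp classical_sets.
From HB Require Import structures.
From mathcomp Require Import zify.

Set Implicit Arguments.
Unset Strict Implicit.
Unset Printing Implicit Defensive.

Import Order.TTheory GRing.Theory Num.Theory.

Local Open Scope classical_set_scope.
Local Open Scope ring_scope.
Local Open Scope quotient_scope.

(** * Zeros, and maps out of a Rees quotient *)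

Lemma is_zero_uniq (S : semigroupType) (y z : S) : is_zero y -> is_zero z -> y = z.
Proof. by move=> yz zz; rewrite -(yz z).1 (zz y).2. Qed.

Lemma greenD_refl (S : semigroupType) (x : S) : greenD x x.
Proof. by exists x. Qed.

(** First isomorphism theorem for the Rees congruence: later isomorphisms can be given on triples,
    with no choice of representatives. *)
Lemma isomorphic_rees (S T : semigroupType) (I : ideal S) (g : S -> T) :
  {morph g : x y / (x * y)%g} -> (forall t, exists x, g x = t) ->
  (forall x y, g x = g y <-> x = y \/ ideal_set I x /\ ideal_set I y) ->
  isomorphic (rees I) T.
Proof.
move=> gM gsurj gker.
have gpi x : g (repr (\pi_(rees I) x)) = g x.
  by apply/gker/(rees_piP I); rewrite reprK.
pose h (q : rees I) : T := g (repr q).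
have hM : {morph h : x y / (x * y)%g} by move=> x y; rewrite /h -gM -[RHS]gpi.
pose h' : {multiplicative rees I -> T} := HB.pack h (isMultiplicative.Build _ _ h hM).
have [k kK] := choice gsurj.
exists h'; exists (fun t => \pi_(rees I) (k t)) => [q|t]; last by rewrite /= /h gpi kK.
apply/eqP; rewrite -[q in _ == q]reprK; apply/(rees_piP I)/gker.
by rewrite kK.
Qed.

(** * Green's relations and the third coordinate *)

Section Elements.
Variables (F : omegaFamily) (F0 : omega_fam F set0).

Definition bz_pi : bz_ext F -> BZ F0 := \pi_(rees (bz_ideal F0)).

Lemma bz_piM x y : bz_pi (x * y)%g = (bz_pi x * bz_pi y)%g.
Proof. by rewrite /bz_pi -[LHS]pi_rees_mul. Qed.

Lemma bz_pi_surj (q : BZ F0) : exists x, q = bz_pi x.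
Proof. by exists (repr q); rewrite /bz_pi reprK. Qed.

Lemma bz_pi_eq x y :
  bz_pi x = bz_pi y <-> x = y \/ val x.2 = set0 /\ val y.2 = set0.
Proof. by split=> [/eqP/(rees_piP (bz_ideal F0))|/(rees_piP (bz_ideal F0))/eqP]. Qed.

Definition bz_elt i j A (FA : omega_fam F A) : bz_ext F :=
  (i, j, exist _ A (mem_set FA)).

Lemma bz_eltP (x : bz_ext F) : exists i j A (FA : omega_fam F A), x = bz_elt i j FA.
Proof.
case: x => [[i j] [A FA]]; exists i, j, A, (set_mem FA).
by congr (_, _); apply: val_inj.
Qed.

Lemma bz_mulE (x y : bz_ext F) :
  [/\ (x * y)%g.1.1 = x.1.1 + Num.max 0 (y.1.1 - x.1.2),
      (x * y)%g.1.2 = y.1.2 + Num.max 0 (x.1.2 - y.1.1) &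
      val (x * y)%g.2 =
      shift (Num.min 0 (x.1.2 - y.1.1)) (val x.2) `&`
      shift (Num.min 0 (y.1.1 - x.1.2)) (val y.2)].
Proof.
have : bz_raw (x * y)%g = _ := bz_raw_mul x y.
case: (x * y)%g => -[m n] C; case: x y => [[i j] A] [[k l] B].
by rewrite [RHS]bz_rawmulE /bz_raw /= => -[-> -> ->].
Qed.

Lemma bz_pi_zero x : val x.2 = set0 -> is_zero (bz_pi x).
Proof.
move=> x0 q; have [y ->] := bz_pi_surj q.
rewrite -!bz_piM; split; apply/bz_pi_eq; right; split=> //.
  exact: (@bz_null_mulr F y x).
exact: (@bz_null_mull F y x).
Qed.

Lemma bz_zeroP x z : is_zero z -> bz_pi x = z <-> val x.2 = set0.
Proof.
move=> zz; split=> [xz|/bz_pi_zero/is_zero_uniq]; last exact.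
have n0 : is_zero (bz_pi (bz_elt 0 0 F0)) by apply: bz_pi_zero.
have /bz_pi_eq[->//|[]//] : bz_pi x = bz_pi (bz_elt 0 0 F0).
by rewrite xz; apply: is_zero_uniq.
Qed.

(** A left factor raises the second coordinate of [y] by some n >= 0 and translates its set by -n
    before intersecting. As [x] is nonzero, the Rees collapse does not interfere. *)
Lemma left_ideal1_bz x y : val x.2 <> set0 ->
  left_ideal1 (bz_pi y) (bz_pi x) ->
  y.1.2 <= x.1.2 /\ val x.2 `<=` shift (y.1.2 - x.1.2) (val y.2).
Proof.
move=> x0 [/= /bz_pi_eq[->|[/x0[]]]|[s _]]; first by rewrite subrr shift0; split.
have [t ->] := bz_pi_surj s; rewrite -bz_piM => /bz_pi_eq[<-|[_ /x0[]]].
have [_ e2 e3] := bz_mulE t y; rewrite e2 e3; split; first by lia.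
rewrite (_ : y.1.2 - _ = Num.min 0 (y.1.1 - t.1.2)); [exact: subIsetr|lia].
Qed.

Lemma right_ideal1_bz x y : val x.2 <> set0 ->
  right_ideal1 (bz_pi y) (bz_pi x) ->
  y.1.1 <= x.1.1 /\ val x.2 `<=` shift (y.1.1 - x.1.1) (val y.2).
Proof.
move=> x0 [/= /bz_pi_eq[->|[/x0[]]]|[s _]]; first by rewrite subrr shift0; split.
have [t ->] := bz_pi_surj s; rewrite -bz_piM => /bz_pi_eq[<-|[_ /x0[]]].
have [e1 _ e3] := bz_mulE y t; rewrite e1 e3; split; first by lia.
rewrite (_ : y.1.1 - _ = Num.min 0 (y.1.2 - t.1.1)); [exact: subIsetl|lia].
Qed.

(** Divisibility in both directions forces equal second coordinates, so both inclusions are between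
    untranslated sets. *)
Lemma greenL_bz x y : val x.2 <> set0 ->
  greenL (bz_pi x) (bz_pi y) -> val x.2 = val y.2.
Proof.
move=> x0 xy; have /(left_ideal1_bz x0)[le1 sub1] : left_ideal1 (bz_pi y) (bz_pi x).
  by rewrite -xy; left.
have y0 : val y.2 <> set0.
  by move=> y0; apply: x0; apply/seteqP; split=> // k /sub1; rewrite y0 /shift image_set0.
have /(left_ideal1_bz y0)[le2] : left_ideal1 (bz_pi x) (bz_pi y) by rewrite xy; left.
have e : x.1.2 = y.1.2 by apply: le_anti; rewrite le1 le2.
by move: sub1; rewrite e !subrr !shift0 => ? ?; apply/seteqP.
Qed.

Lemma greenR_bz x y : val x.2 <> set0 ->
  greenR (bz_pi x) (bz_pi y) -> val x.2 = val y.2.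
Proof.
move=> x0 xy; have /(right_ideal1_bz x0)[le1 sub1] : right_ideal1 (bz_pi y) (bz_pi x).
  by rewrite -xy; left.
have y0 : val y.2 <> set0.
  by move=> y0; apply: x0; apply/seteqP; split=> // k /sub1; rewrite y0 /shift image_set0.
have /(right_ideal1_bz y0)[le2] : right_ideal1 (bz_pi x) (bz_pi y) by rewrite xy; left.
have e : x.1.1 = y.1.1 by apply: le_anti; rewrite le1 le2.
by move: sub1; rewrite e !subrr !shift0 => ? ?; apply/seteqP.
Qed.

Lemma greenD_bz x y : val x.2 <> set0 ->
  greenD (bz_pi x) (bz_pi y) -> val x.2 = val y.2.
Proof.
move=> x0 [q]; have [z ->] := bz_pi_surj q => -[/(greenL_bz x0) xz].
by rewrite xz => /greenR_bz -> //; rewrite -xz.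
Qed.

Lemma zero_bisimple_bz_family : zero_bisimple (BZ F0) ->
  exists2 A, A <> set0 & omega_fam F = [set set0; A].
Proof.
move=> [_ [z zz classes]].
(* Pick a point whose class is the complement of zero; by reflexivity it lies in that class, hence
   is nonzero. *)
have [q _ Dq] : range (@Dclass (BZ F0)) (~` [set z]) by rewrite classes; left.
have [x xq] := bz_pi_surj q.
have nz : q <> z.
  by move=> qz; have := greenD_refl q; rewrite -[greenD q q]/(Dclass q q) Dq; apply.
have x0 : val x.2 <> set0 by move=> /(bz_zeroP _ zz); rewrite -xq.
exists (val x.2) => //; apply/seteqP; split=> [B FB|B [->//|->]]; last first.
  exact: set_mem (valP x.2).
have [->|/eqP B0] := eqVneq B set0; [by left|right].
have : Dclass q (bz_pi (bz_elt 0 0 FB)).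
  by rewrite Dq => /= /(bz_zeroP _ zz).
by rewrite xq => /(greenD_bz x0).
Qed.

End Elements.

(** * Isomorphisms by translation and with matrix units *)

Lemma isomorphic_bz_shift (F G : omegaFamily) (F0 : omega_fam F set0)
    (G0 : omega_fam G set0) (s : int) :
  omega_fam G = [set shift s A | A in omega_fam F] ->
  isomorphic (BZ F0) (BZ G0).
Proof.
move=> FG; have sG (x : bz_ext F) : omega_fam G (shift s (val x.2)).
  by rewrite FG; exists (val x.2) => //; apply: set_mem (valP x.2).
have sI : injective (shift s).
  by move=> A B /(congr1 (shift (- s))); rewrite !shiftD addNr !shift0.
have s0 A : shift s A = set0 <-> A = set0.
  by split=> [e|->]; [apply: sI; rewrite e|]; rewrite /shift image_set0.
pose g (x : bz_ext F) : bz_ext G := bz_elt x.1.1 x.1.2 (sG x).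
apply: (@isomorphic_rees _ _ _ (fun x => bz_pi G0 (g x))).
- move=> x y; rewrite -bz_piM; congr bz_pi; apply: bz_raw_inj.
  have [e1 e2 e3] := bz_mulE x y.
  have gE z : bz_raw (g z) = (z.1.1, z.1.2, shift s (val z.2)) by [].
  rewrite bz_raw_mul !gE bz_rawmulE e1 e2 e3 shiftI !shiftD.
  by congr (_, _, shift _ _ `&` shift _ _); rewrite addrC.
- move=> q; have [y ->] := bz_pi_surj q.
  have [i [j [B [GB ->]]]] := bz_eltP y.
  have [A FA AB] : [set shift s A | A in omega_fam F] B by rewrite -FG.
  exists (bz_elt i j FA); congr bz_pi.
  by apply: bz_raw_inj; rewrite /bz_raw /= AB.
- move=> x y; split=> [/bz_pi_eq[e|[/s0 ? /s0 ?]]|[->//|[x0 y0]]]; [left|by right|].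
    apply: bz_raw_inj; have := congr1 (@bz_raw G) e; rewrite /bz_raw /=.
    by case: (x) (y) => [[? ?] ?] [[? ?] ?] /= [-> -> /sI ->].
  by apply/bz_pi_eq; right; split; apply/s0.
Qed.

(** Zigzag enumeration of the integers: triples have integer indices, matrix units natural ones. *)
Definition nat_of_int (n : int) : nat :=
  match n with Posz m => m.*2 | Negz m => m.*2.+1 end.

Definition int_of_nat (n : nat) : int := if odd n then Negz n./2 else Posz n./2.

Lemma nat_of_intK : cancel nat_of_int int_of_nat.
Proof. by case=> n; rewrite /int_of_nat /= odd_double ?doubleK ?uphalf_double. Qed.

Lemma int_of_natK : cancel int_of_nat nat_of_int.
Proof.
by move=> n; rewrite /int_of_nat -[RHS]odd_double_half; case: (odd n).
Qed.

(** Distinct translates of a singleton are disjoint, so a product of nonzero elements is nonzero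
    exactly when the inner indices agree, as for matrix units. *)
Lemma isomorphic_bz_singleton (F : omegaFamily) (F0 : omega_fam F set0) (a : int) :
  omega_fam F = [set set0; [set a]] -> isomorphic (BZ F0) matrix_units.
Proof.
move=> FE; have a0 : [set a] <> set0 :> set int.
  by move=> /seteqP[/(_ a) + _]; apply.
have xP (x : bz_ext F) : val x.2 = set0 \/ val x.2 = [set a].
  have [i [j [A [FA ->]]]] := bz_eltP x; move: (FA); rewrite /= FE => -[]; by [left|right].
pose g (x : bz_ext F) : matrix_units :=
  if `[< val x.2 = set0 >] then None else Some (nat_of_int x.1.1, nat_of_int x.1.2).
have g0 x : val x.2 = set0 -> g x = None by move=> x0; rewrite /g asboolT.
have g1 x : val x.2 = [set a] -> g x = Some (nat_of_int x.1.1, nat_of_int x.1.2).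
  by move=> x1; rewrite /g asboolF// x1.
apply: (@isomorphic_rees _ _ _ g).
- move=> x y.
  case: (xP x) => [x0|xa].
    by rewrite (g0 _ x0) g0//; apply: (@bz_null_mulr F y x).
  case: (xP y) => [y0|ya].
    by rewrite (g0 _ y0) g0; [case: (g x) => [[]|]|apply: (@bz_null_mull F x y)].
  have [e1 e2 e3] := bz_mulE x y.
  rewrite -[RHS]/(matrix_units_mul (g x) (g y)) (g1 _ xa) (g1 _ ya) /= (can_eq nat_of_intK).
  case: eqVneq => [xy|xy].
    by rewrite g1 ?e1 ?e2 ?e3 xy subrr ?addr0// minxx !shift0 xa ya setIid.
  rewrite g0// e3 xa ya !shiftE; apply/seteqP; split=> // k [/= ka kb].
  (* One of the two minima is 0 and the other is -|p - q|, so [k] can lie in both translates only if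
     they coincide. *)
  have minE (p q : int) : k - Num.min 0 (p - q) = a -> k - Num.min 0 (q - p) = a -> p = q.
    by lia.
  by move/eqP: xy; apply; apply: minE.
- case=> [[i j]|]; last by exists (bz_elt 0 0 F0); rewrite g0.
  have FA : omega_fam F [set a] by rewrite FE; right.
  by exists (bz_elt (int_of_nat i) (int_of_nat j) FA); rewrite g1 //= !int_of_natK.
- move=> x y; split=> [|[->//|[x0 y0]]]; last by rewrite !g0.
  case: (xP x) (xP y) => [x0|xa] [y0|ya].
  + by right.
  + by rewrite (g0 _ x0) (g1 _ ya).
  + by rewrite (g0 _ y0) (g1 _ xa).
  rewrite !g1// => -[/(can_inj nat_of_intK) e1 /(can_inj nat_of_intK) e2]; left.
  apply: bz_raw_inj; rewrite /bz_raw xa ya.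
  by move: e1 e2; case: (x.1) (y.1) => [? ?] [? ?] /= -> ->.
Qed.

(** * Closed families with a single nonempty member *)

(* The least positive [d] such that [A] meets its translate by [d] generates all
   differences of elements of [A]. *)
Lemma closed_pair_family_prog (F : omegaFamily) (A : set int) :
  A <> set0 -> omega_fam F = [set set0; A] ->
  (exists a, A = [set a]) \/
  exists a d : nat, (0 < d)%N /\ A = progression a d.
Proof.
move=> A0 FE; have FA : omega_fam F A by rewrite FE; right.
have Anat k : A k -> exists n : nat, k = n.
  by move=> /(omega_fam_sub FA)[n _ <-]; exists n.
have exA : exists n : nat, `[< A n >].
  have /set0P[k Ak] : A != set0 by apply/eqP.
  by have [n kn] := Anat _ Ak; exists n; apply/asboolP; rewrite -kn.
case: (ex_minnP exA) => a /asboolP Aa amin.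
(* If [n] is a difference of two elements of [A], then [A] meets its translate by [-n]; the
   intersection is therefore [A] itself, and adding [n] preserves [A]. *)
have AD (n : nat) k : A k -> A (k + n%:Z) -> forall l, A l -> A (l + n%:Z).
  move=> Ak Akn l Al; have := omega_fam_closed n FA FA.
  rewrite {1}FE => -[e|e].
    suff : set0 k by [].
    by rewrite -e; split=> //; rewrite shiftE /= opprK.
  by move: Al; rewrite -{1}e shiftE => -[_ /=]; rewrite opprK.
have [sing|nsing] := pselect (A = [set a%:Z]); [by left; exists a|right].
have exd : exists d : nat, (0 < d)%N && `[< A (a%:Z + d%:Z) >].
  apply/not_existsP => nd; apply: nsing; apply/seteqP; split=> [k Ak|_ -> //].
  have [n kn] := Anat _ Ak; subst k.
  have an : (a <= n)%N by apply: amin; apply/asboolP.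
  have [->//|na] := eqVneq n a.
  case: (nd (n - a)%N); apply/andP; split; first by lia.
  by apply/asboolP; rewrite (_ : _ + _ = n%:Z)//; lia.
case: (ex_minnP exd) => d /andP[d0 /asboolP Aad] dmin.
have Aadm (m : nat) : A (a%:Z + (d * m)%N%:Z).
  elim: m => [|m IH]; first by rewrite muln0 addr0.
  by rewrite mulnS addnC PoszD addrA; apply: (AD d a).
exists a, d; split=> //; apply/seteqP; split=> [k Ak|_ [_ [_ [m _ <-] <-] <-]]; last first.
  by have := Aadm m; rewrite PoszM.
have [n kn] := Anat _ Ak; subst k.
have an : (a <= n)%N by apply: amin; apply/asboolP.
have ndiv := divn_eq (n - a) d; have rd := ltn_pmod (n - a) d0.
set q := ((n - a) %/ d)%N in ndiv; set r := ((n - a) %% d)%N in ndiv rd.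
(* Both a + dq and n = a + dq + r lie in [A], so [AD] puts a + r in [A]; a positive [r] below [d]
   would contradict the minimality of [d]. *)
have r0 : r = 0%N.
  apply/eqP; rewrite -leqn0 leqNgt; apply/negP => r0.
  suff : (d <= r)%N by rewrite leqNgt rd.
  apply: dmin; rewrite r0; apply/asboolP.
  apply: (AD r (a%:Z + (d * q)%N%:Z)) => //.
  by rewrite (_ : _ + _ = n%:Z)//; lia.
exists (d%:Z * q%:Z); first by exists q%:Z => //; exists q.
by rewrite -PoszM; lia.
Qed.

(** * The two cases exclude each other *)

Lemma matrix_units_idem_le (e f : matrix_units) :
  (e * e)%g = e -> (f * f)%g = f -> (e * f)%g = f -> f <> None -> e = f.
Proof.
case: f e => [[c d]|//] [[a b]|//].
(* Idempotence makes both pairs diagonal, and diagonal pairs with nonzero product coincide. *)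
rewrite -[LHS]/(matrix_units_mul _ _) /=; case: eqP => // -> _.
rewrite -[LHS]/(matrix_units_mul _ _) /=; case: eqP => // -> _.
by rewrite -[LHS]/(matrix_units_mul _ _) /=; case: eqP => // ->.
Qed.

(* In the progression semigroup the idempotent at [(j0, j0)] lies strictly below
   the one at [(0, 0)], whereas nonzero idempotents of matrix units are pairwise
   incomparable. *)
Lemma bz_prog_not_sub_matrix_units (i0 j0 : nat) (k : BZprog i0 j0 -> matrix_units) :
  (0 < j0)%N -> {morph k : x y / (x * y)%g} -> ~ injective k.
Proof.
move=> j0_gt0 kM kI; set P := progression i0 j0.
have FP : omega_fam (prog_family i0 j0) P by right.
have P0 : P <> set0.
  move=> /seteqP[/(_ i0%:Z) + _]; apply; exists 0; last by rewrite addr0.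
  by exists 0; [exists 0%N|rewrite mulr0].
have PI : shift (- j0%:Z) P `&` P = P.
  apply: setIidr => _ [_ [_ [m _ <-] <-] <-]; rewrite shiftE /= opprK.
  exists (j0%:Z * m.+1%:Z); last by lia.
  by exists m.+1%:Z => //; exists m.+1.
pose x i j : BZprog i0 j0 := bz_pi (prog_family0 i0 j0) (bz_elt i j FP).
have xI i j i' j' : x i j = x i' j' -> (i, j) = (i', j').
  by move=> /bz_pi_eq[[-> ->]|[/P0]].
have xM i j l : (x i j * x j l)%g = x i l.
  rewrite /x -bz_piM; congr bz_pi; apply: bz_raw_inj.
  by rewrite bz_raw_mul bz_rawmulE subrr maxxx minxx !shift0 !addr0 setIid.
have xM0 : (x 0 0 * x j0 j0)%g = x j0 j0.
  rewrite /x -bz_piM; congr bz_pi; apply: bz_raw_inj.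
  rewrite bz_raw_mul bz_rawmulE.
  have -> : Num.min 0 (0 - j0%:Z) = - j0%:Z by lia.
  have -> : Num.min 0 (j0%:Z - 0) = 0 by lia.
  by rewrite shift0 PI; congr (_, _, _); lia.
have e : k (x 0 0) = k (x j0 j0).
  apply: matrix_units_idem_le; rewrite -?kM ?xM ?xM0// => kN.
  (* If [k] killed [x j0 j0], it would also kill its right multiple [x j0 (j0 + 1)], against
     injectivity. *)
  have : k (x j0 j0 * x j0 (j0%:Z + 1))%g = k (x j0 j0) by rewrite kM kN.
  by rewrite xM => /kI/xI[]; lia.
by move/kI/xI: e => -[]; lia.
Qed.

Theorem mainTheorem11 (F : omegaFamily) (F0 : omega_fam F set0) :
  zero_bisimple (BZ F0) ->
  let P1 := isomorphic (BZ F0) matrix_units in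
  let P2 := exists2 j0 : nat, (0 < j0)%N & isomorphic (BZ F0) (BZprog 0 j0) in
  (P1 \/ P2) /\ ~ (P1 /\ P2).
Proof.
move=> /zero_bisimple_bz_family[A A0 FE] P1 P2; split.
  have [[a Aa]|[a [d [d0 Ad]]]] := closed_pair_family_prog A0 FE.
    by left; apply: (@isomorphic_bz_singleton _ _ a); rewrite FE Aa.
  (* Translating by [-a] makes the progression start at 0. *)
  right; exists d => //; apply: (@isomorphic_bz_shift _ _ _ _ (- a%:Z)).
  by rewrite FE Ad image_setU !image_set1 {1}/shift image_set0 shiftD addNr.
case=> -[f [g fK gK]] [d d0 [h [k hK kK]]].
(* The inverse of [h] is multiplicative, so [f \o k] would embed the progression semigroup in the
   matrix units. *)
have kM : {morph k : x y / (x * y)%g} by move=> x y; apply: (can_inj hK); rewrite gmulfM !kK.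
apply: (bz_prog_not_sub_matrix_units (k := f \o k) d0) => [x y|].
  by rewrite /= kM gmulfM.
exact: inj_comp (can_inj fK) (can_inj kK).
Qed.
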